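(* Let $\Gamma(G)$ be a connected signed graph on $n$ vertices, let $v$ be a cut-point of $\Gamma(G)$, and let $\Gamma(G_1),\Gamma(G_2),\ldots,\Gamma(G_s)$ be all the connected components of $\Gamma(G-v)$. If there is a component, say $\Gamma(G_1)$, such that $\eta(\Gamma(G_1))=\eta(\Gamma(G_1+v))+1$, then $$\eta(\Gamma(G))=\eta(\Gamma(G-v))-1=\sum_{i=1}^{s}\eta(\Gamma(G_i))-1.$$
   Context: A signed graph $\Gamma(G)=(G,\sigma)$ consists of a simple graph $G=(V,E)$ and a map $\sigma:E\to\{+,-\}$; its adjacency matrix has $(i,j)$ entry $\sigma(v_iv_j)$ if $v_iv_j\in E$ and $0$ otherwise, and its nullity $\eta(\Gamma(G))$ is the multiplicity of the eigenvalue $0$ of this matrix. Subgraphs inherit signs. A cut-point is a vertex $v$ whose removal disconnects $G$. $G-v$ denotes $G$ with $v$ and its incident edges removed; for an induced subgraph $G_1$ and a vertex $v\notin V(G_1)$, $G_1+v$ denotes the subgraph induced by $V(G_1)\cup\{v\}$. *)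

(* Defs.v *)
From mathcomp Require Import all_boot all_order all_algebra.

Set Implicit Arguments.
Unset Strict Implicit.
Unset Printing Implicit Defensive.

Import GRing.Theory Num.Theory.
Local Open Scope ring_scope.

(* Simple graphs with vertex set the whole finite type T. *)
Record sgraph (T : finType) := SGraph {
  edge :> rel T;
  edge_sym : symmetric edge;
  edge_irr : irreflexive edge
}.

(* The sign map is encoded by [negative]: the edge xy has sign - when
   [negative x y] is true and + otherwise.  Only its values on edges matter;
   [negative_sym] makes it a function of the unordered edge. *)
Record signed_graph (T : finType) := SignedGraph {
  graph_of :> sgraph T;
  negative : rel T;
  negative_sym : forall x y, edge graph_of x y -> negative x y = negative y x
}.

Section Induced.
Variables (T : finType) (G : signed_graph T) (A : {set T}).

Let V := {x : T | x \in A}.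

Definition induced_edge : rel V := fun x y => edge G (val x) (val y).

Lemma induced_edge_sym : symmetric induced_edge.
Proof. by move=> x y; apply: edge_sym. Qed.

Lemma induced_edge_irr : irreflexive induced_edge.
Proof. by move=> x; apply: edge_irr. Qed.

Definition induced_sgraph : sgraph V :=
  SGraph induced_edge_sym induced_edge_irr.

Definition induced_negative : rel V := fun x y => negative G (val x) (val y).

Lemma induced_negative_sym (x y : V) :
  edge induced_sgraph x y -> induced_negative x y = induced_negative y x.
Proof. by move=> xy; apply: negative_sym. Qed.

Definition induced : signed_graph V :=
  @SignedGraph V induced_sgraph induced_negative induced_negative_sym.

End Induced.

Section Defs.
Variable T : finType.
Implicit Type G : signed_graph T.

Definition delv G (v : T) : signed_graph {x : T | x \in [set~ v]} :=
  induced G [set~ v].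

(* The vertices are ordered by their enumeration in T. *)
Definition adjmx (R : realFieldType) G : 'M[R]_#|T| :=
  \matrix_(i, j) if edge G (enum_val i) (enum_val j)
                 then (-1) ^+ negative G (enum_val i) (enum_val j) else 0.

(* Multiplicity of 0 as a root of the characteristic polynomial. *)
Definition nullity (R : realFieldType) G : nat := mup 0 (char_poly (adjmx R G)).

Definition connected G : Prop := forall x y : T, connect (edge G) x y.

(* The vertex sets of the connected components. *)
Definition components G : {set {set T}} :=
  equivalence_partition (connect (edge G)) [set: T].

End Defs.

(* Meant for a connected G.  The empty graph counts as connected here, so the
   vertex of a one-vertex graph is not a cut-point. *)
Definition cut_point (T : finType) (G : signed_graph T) (v : T) : Prop :=
  ~ connected (delv G v).

(* Main.v *)
(* Since the adjacency matrix is real symmetric, the nullity is the number of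
   vertices minus the rank, so the claim is that deleting [v] lowers the rank by
   exactly 2.  Let b be the row of [v]: bordering a symmetric matrix N by b, with
   diagonal entry 0, raises the rank by 2 if b is outside the row space of N, and
   by at most 1 otherwise.  The hypothesis says that the rank grows by 2 from G_1
   to G_1 + v, so the part of b on G_1 is outside the row space of G_1.  As G_1 is
   a component, G - v is block diagonal, so b is outside its row space too. *)

Require Import Defs.
From mathcomp Require Import all_boot all_order all_algebra.

Set Implicit Arguments.
Unset Strict Implicit.
Unset Printing Implicit Defensive.

Import GRing.Theory Num.Theory.
Local Open Scope ring_scope.

(** * Nullity of a symmetric matrix as its corank *)

(* Both sides come from eliminating one off-diagonal block of
   [block_mx x%:M C D 1%:M]. *)
Lemma det_scalar_subM (F : comUnitRingType) (n r : nat)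
    (x : F) (C : 'M[F]_(n, r)) (D : 'M[F]_(r, n)) :
  x ^+ r * \det (x%:M - C *m D) = x ^+ n * \det (x%:M - D *m C).
Proof.
pose B := block_mx x%:M C D 1%:M.
have <- : \det B = \det (x%:M - C *m D).
  have E : B *m block_mx 1%:M 0 (- D) 1%:M
    = block_mx (x%:M - C *m D) C 0 1%:M.
    by rewrite mulmx_block !mulmx1 !mulmx0 !mul1mx !mulmxN !add0r addrN.
  have := det_mulmx B (block_mx 1%:M 0 (- D) 1%:M).
  by rewrite E det_ublock det_lblock !det1 !mulr1 => ->.
have E : B *m block_mx 1%:M (- C) 0 x%:M = block_mx x%:M 0 D (x%:M - D *m C).
  rewrite mulmx_block !mulmx1 !mulmx0 !mul1mx !mulmxN !addr0.
  by rewrite mul_scalar_mx mul_mx_scalar addNr addrC.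
have /(congr1 determinant) := E.
by rewrite det_mulmx det_ublock det_lblock det1 !det_scalar mul1r mulrC.
Qed.

Lemma char_poly_mulC (F : fieldType) (n r : nat)
    (C : 'M[F]_(n, r)) (D : 'M[F]_(r, n)) :
  'X^r * char_poly (C *m D) = 'X^n * char_poly (D *m C).
Proof. by rewrite /char_poly /char_poly_mx !map_mxM det_scalar_subM. Qed.

(** The order on [R] enters here: a sum of squares vanishes only termwise. *)
Lemma row_sqr_eq0 (R : realFieldType) n (w : 'rV[R]_n) :
  w *m w^T = 0 -> w = 0.
Proof.
move/matrixP/(_ 0 0); rewrite !mxE => w0; apply/rowP=> j; rewrite mxE.
have /psumr_eq0P : forall i, true -> 0 <= w 0 i * w^T i 0.
  by move=> i _; rewrite mxE -expr2 sqr_ge0.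
by move/(_ w0 j isT)/eqP; rewrite mxE mulf_eq0 orbb => /eqP.
Qed.

(* Symmetry over an ordered field forces [ker A] to meet the row space of [A]
   trivially, so in a full-rank factorization [A = C D] the matrix [D C] is
   invertible and contributes no root 0. *)
Lemma mup0_char_poly_sym (R : realFieldType) n (A : 'M[R]_n) :
  A^T = A -> (mup 0 (char_poly A) + \rank A)%N = n.
Proof.
move=> symA; set D := row_base A; set C := col_base A.
have defA : A = C *m D by rewrite mulmx_base.
have free_DC : row_free (D *m C).
  rewrite -kermx_eq0; apply/rowV0P=> u /sub_kermxP uDC0.
  have uDA0 : u *m D *m A = 0.
    transitivity (u *m (D *m C) *m D); last by rewrite uDC0 mul0mx.
    by rewrite [X in _ *m X = _]defA !mulmxA.
  have /submxP[y wE] : (u *m D <= A)%MS by rewrite -(eq_row_base A) submxMl.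
  suff /row_sqr_eq0/eqP w0 : (u *m D) *m (u *m D)^T = 0.
    by apply/eqP; rewrite -(mulmx_free_eq0 u (row_base_free A)).
  by rewrite {2}wE trmx_mul symA mulmxA uDA0 mul0mx.
have nroot0 : ~~ root (char_poly (D *m C)) 0.
  rewrite rootE horner_coef0 char_poly_det mulf_eq0 signr_eq0 /=.
  by rewrite -unitfE -unitmxE -row_free_unit.
(* The root 0 has multiplicity [\rank A] plus that in [char_poly A] on the left, and exactly [n] on
   the right. *)
have := congr1 (mup 0) (char_poly_mulC C D).
have Xn m : 'X^m = ('X - 0%:P) ^+ m :> {poly R} by rewrite subr0.
have chneq0 k (B : 'M[R]_k) : char_poly B != 0 by rewrite monic_neq0 ?char_poly_monic.
rewrite !mupM ?chneq0 ?monic_neq0 ?monicXn // -defA !Xn !mup_XsubCX eqxx.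
by rewrite (mupNroot nroot0) addn0 addnC.
Qed.

(** * Rank of a bordered symmetric matrix *)

Section Bordering.
Variables (F : fieldType) (n : nat) (N : 'M[F]_n) (e b : 'rV[F]_n).

(** Every row of the bordered matrix lies in the row space of [N] enlarged by the single row [e]. *)
Lemma rank_border_le :
  (b <= N)%MS -> (\rank (N + e^T *m b + b^T *m e)%R <= \rank N + 1)%N.
Proof.
move=> bN; have sub : ((N + e^T *m b + b^T *m e)%R <= N + e)%MS.
  apply: addmx_sub_adds; last exact: submxMl.
  by apply: addmx_sub => //; apply: mulmx_sub.
apply: leq_trans (mxrankS sub) _; apply: leq_trans (mxrank_adds_leqif N e) _.
by rewrite leq_add2l rank_leq_row.
Qed.

(** The row space of the bordered matrix is that of [N] enlarged by [b] and then by [e], and both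
    enlargements are strict. In the application [e] is the unit row of the added vertex. *)
Lemma rank_border :
  N^T = N -> N *m e^T = 0 -> b *m e^T = 0 -> e *m e^T = 1%:M ->
  ~~ (b <= N)%MS -> \rank (N + e^T *m b + b^T *m e)%R = (\rank N + 2)%N.
Proof.
move=> symN Ne be ee bN; set M := (N + _ + _)%R.
have eN : e *m N = 0 by rewrite -symN -[e]trmxK -trmx_mul Ne trmx0.
have eb : e *m b^T = 0 by rewrite -[e]trmxK -trmx_mul be trmx0.
have symM : M^T = M.
  by rewrite /M !linearD /= !trmx_mul !trmxK symN -!addrA [_ *m b + _]addrC.
have bM : (b <= M)%MS.
  suff <- : e *m M = b by apply: submxMl.
  by rewrite /M !mulmxDr !mulmxA eN ee eb mul1mx mul0mx add0r addr0.
(* As [b] is outside the row space of [N], some column [x] killed by [N] has [b *m x] nonzero.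
   Removing its component along [e] gives [x'] with [M *m x' = c *: e^T]; transposing puts [e] in
   the row space of [M]. *)
have eM : (e <= M)%MS.
  have [j cj] : exists j, (b *m cokermx N) 0 j != 0.
    by apply/rV0Pn; rewrite -submxE.
  set c := (b *m cokermx N) 0 j in cj.
  pose x := col j (cokermx N); pose x' := x - e^T *m (e *m x).
  have Nx : N *m x' = 0.
    rewrite mulmxBr !mulmxA Ne !mul0mx subr0 /x colE mulmxA.
    by rewrite mulmx_coker mul0mx.
  have bx : b *m x' = c%:M.
    rewrite mulmxBr !mulmxA be !mul0mx subr0 /x colE mulmxA -colE.
    by rewrite [LHS]mx11_scalar mxE.
  have ex : e *m x' = 0 by rewrite mulmxBr !mulmxA ee mul1mx subrr.
  have Mx : M *m x' = c *: e^T.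
    rewrite /M !mulmxDl -!mulmxA Nx bx ex mulmx0 addr0 add0r.
    by rewrite mul_mx_scalar.
  rewrite -(eqmx_scale _ cj) -[e]trmxK -linearZ /= -Mx trmx_mul symM.
  exact: submxMl.
have NM : (N <= M)%MS.
  have -> : N = M - (e^T *m b + b^T *m e) by rewrite /M -[N + _ + _]addrA addrK.
  by rewrite addmx_sub // eqmx_opp addmx_sub ?mulmx_sub.
have sub : ((N + b) + e <= M)%MS by rewrite !addsmx_sub NM bM eM.
have ltNb : (N < N + b)%MS.
  by rewrite ltmxE addsmxSl /= addsmx_sub submx_refl.
have ltNbe : (N + b < (N + b) + e)%MS.
  rewrite ltmxE addsmxSl /= addsmx_sub submx_refl /=.
  (* [e] is orthogonal to [b] and to the rows of [N], but not to itself. *)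
  apply/negP=> /sub_addsmxP[[u w] /= eE].
  have : e *m e^T = 0 by rewrite {1}eE mulmxDl -!mulmxA Ne be !mulmx0 addr0.
  by rewrite ee => /matrixP/(_ 0 0)/eqP; rewrite !mxE oner_eq0.
apply/eqP; rewrite eqn_leq; apply/andP; split; last first.
  rewrite addn2; apply: leq_trans (mxrankS sub).
  by apply: leq_ltn_trans (rank_ltmx ltNb) (rank_ltmx ltNbe).
have /mxrankS/leq_trans : (M <= (N + b) + e)%MS.
  by rewrite /M !addmx_sub_adds ?submx_refl ?submxMl.
apply; apply: leq_trans (mxrank_adds_leqif _ e) _.
rewrite (addnA _ 1 1)%N leq_add ?rank_leq_row //.
by apply: leq_trans (mxrank_adds_leqif N b) _; rewrite leq_add2l rank_leq_row.
Qed.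

End Bordering.

(** * Adjacency matrices of induced subgraphs *)

(* Principal submatrices are kept at full size and padded with zeros, so that
   all the induced subgraphs live in the same row space. *)
Definition mask (R : nzRingType) (T : finType) (A : {set T}) : 'M[R]_#|T| :=
  diag_mx (\row_j (enum_val j \in A)%:R).

Definition restrict_mx (R : nzRingType) (T : finType) (M : 'M[R]_#|T|)
  (A : {set T}) : 'M[R]_#|T| := mask R A *m M *m mask R A.

Lemma maskM (R : nzRingType) (T : finType) (A B : {set T}) :
  mask R A *m mask R B = mask R (A :&: B).
Proof.
apply/matrixP=> i j; rewrite mul_diag_mx !mxE inE.
have [->|] := eqVneq i j; last by rewrite !mulr0n mulr0.
by rewrite !mulr1n -natrM mulnb.
Qed.

Lemma restrict_mxE (R : nzRingType) (T : finType) (M : 'M[R]_#|T|) (A : {set T}) i j :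
  restrict_mx M A i j =
    if (enum_val i \in A) && (enum_val j \in A) then M i j else 0.
Proof.
rewrite /restrict_mx /mask mul_mx_diag mul_diag_mx !mxE.
by do 2!case: (_ \in A); rewrite ?mul1r ?mulr1 ?mul0r ?mulr0.
Qed.

Lemma tr_adjmx (R : realFieldType) (T : finType) (G : signed_graph T) :
  (adjmx R G)^T = adjmx R G.
Proof.
apply/matrixP=> i j; rewrite !mxE edge_sym.
by case: ifP => // /negative_sym ->.
Qed.

Lemma nullityE (R : realFieldType) (T : finType) (G : signed_graph T) :
  (nullity R G + \rank (adjmx R G))%N = #|T|.
Proof. exact/mup0_char_poly_sym/tr_adjmx. Qed.

(** With [E] the 0/1 matrix of [h], [adjmx R H] is [E *m adjmx R G *m E^T] and [E^T *m E] is the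
    mask of the image. Since [E] is row free, multiplying by [E^T] on the left and [E] on the right
    keeps the rank. *)
Lemma rank_adjmx_embed (R : realFieldType) (S T : finType) (h : S -> T)
    (H : signed_graph S) (G : signed_graph T) :
  injective h ->
  (forall x y, edge H x y = edge G (h x) (h y)) ->
  (forall x y, negative H x y = negative G (h x) (h y)) ->
  \rank (adjmx R H) = \rank (restrict_mx (adjmx R G) [set h x | x in S]).
Proof.
move=> injh edgeH negH.
pose f (i : 'I_#|S|) := enum_rank (h (enum_val i)) : 'I_#|T|.
have injf : injective f.
  by move=> i j /enum_rank_inj/injh/enum_val_inj.
pose E : 'M[R]_(#|S|, #|T|) := rowsub f 1%:M.
have trE : E^T = colsub f 1%:M by apply/matrixP=> i j; rewrite !mxE eq_sym.
have adjH : adjmx R H = E *m adjmx R G *m E^T.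
  rewrite trE /E mul_rowsub_mx mul1mx mulmx_colsub mulmx1.
  by apply/matrixP=> i j; rewrite !mxE !enum_rankK edgeH negH.
have EE : E *m E^T = 1%:M.
  rewrite trE /E mul_rowsub_mx mul1mx.
  by apply/matrixP=> i j; rewrite !mxE (inj_eq injf).
have freeE : row_free E by apply/row_freeP; exists E^T.
have fullE : row_full E^T by rewrite /row_full mxrank_tr.
have EtE : E^T *m E = mask R [set h x | x in S].
  apply/matrixP=> i j; rewrite !mxE.
  have [/imsetP[x _ hx]|niS] := boolP (enum_val i \in _).
    have -> : i = f (enum_rank x) by rewrite /f enum_rankK -hx enum_valK.
    rewrite (bigD1 (enum_rank x)) //= !mxE eqxx mul1r big1 ?addr0 // => k.
    by rewrite !mxE (inj_eq injf) => /negPf ->; rewrite mul0r.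
  rewrite mul0rn big1 // => k _; rewrite !mxE.
  case: eqP => [hk|]; last by rewrite mul0r.
  case/imsetP: niS; exists (enum_val k) => //.
  by rewrite -hk enum_rankK.
by rewrite /restrict_mx -EtE !mulmxA mxrankMfree // -!mulmxA eqmxMfull // adjH mulmxA.
Qed.

(** * Additivity of rank and nullity over components *)

Lemma equivalence_connect (T : finType) (G : signed_graph T) :
  {in [set: T] & &, equivalence_rel (connect (edge G))}.
Proof.
have symG := sym_connect_sym (edge_sym G).
move=> x y z _ _ _; split; first exact: connect0.
by move=> xy; rewrite (same_connect symG xy).
Qed.

Lemma components_partition (T : finType) (G : signed_graph T) :
  partition (components G) [set: T].
Proof. exact/equivalence_partitionP/equivalence_connect. Qed.

Lemma edge_components (T : finType) (G : signed_graph T) (C : {set T}) x y :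
  C \in components G -> edge G x y -> (x \in C) = (y \in C).
Proof.
case/imsetP=> z _ ->; rewrite !inE => xy.
by rewrite (same_connect_r (sym_connect_sym (edge_sym G)) (connect1 xy)).
Qed.

Lemma rank_induced (R : realFieldType) (T : finType) (G : signed_graph T)
    (A : {set T}) :
  \rank (adjmx R (induced G A)) = \rank (restrict_mx (adjmx R G) A).
Proof.
rewrite (rank_adjmx_embed R (h := val) (G := G)) //; last exact: val_inj.
congr (\rank (restrict_mx _ _)); apply/setP=> x.
apply/imsetP/idP => [[y _ ->]|xA]; first exact: valP.
by exists (Sub x xA).
Qed.

(** The blocks of different components are supported on disjoint sets of columns, so their row
    spaces form a direct sum. *)
Lemma rank_components (R : realFieldType) (T : finType) (G : signed_graph T) :
  \rank (adjmx R G) = (\sum_(C in components G)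
    \rank (adjmx R (induced G C)))%N.
Proof.
have part := components_partition G; have [_ /trivIsetP triv _] := and3P part.
set P := components G in part triv *; set M := adjmx R G.
pose D (C : {set T}) := mask R C.
(* No edge leaves a component, so masking the rows already masks the columns. *)
have DM C : C \in P -> D C *m M = restrict_mx M C.
  move=> PC; apply/matrixP=> i j; rewrite restrict_mxE mul_diag_mx !mxE.
  have [ij|] := boolP (edge G _ _); last by rewrite mulr0 if_same.
  rewrite (edge_components PC ij) andbb.
  by case: ifP; rewrite ?mul1r ?mul0r.
have DD B C : B \in P -> C \in P -> D B *m D C = if B == C then D C else 0.
  move=> PB PC; rewrite /D maskM; have [->|neqBC] := eqVneq B C.
    by rewrite setIid.
  rewrite (disjoint_setI0 (triv _ _ PB PC neqBC)); apply/matrixP=> i j.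
  by rewrite !mxE inE mul0rn.
(* The masks of the components add up to the identity. *)
have sumM : M = \sum_(C in P) restrict_mx M C.
  rewrite -(eq_bigr _ DM) -mulmx_suml -[LHS]mul1mx; congr (_ *m _).
  apply/matrixP=> i j; rewrite summxE !mxE.
  have iP : enum_val i \in cover P by rewrite (cover_partition part).
  rewrite (bigD1 (pblock P (enum_val i))) ?pblock_mem //= big1 => [|C].
    by rewrite !mxE mem_pblock iP addr0.
  case/andP=> PC neqC; rewrite !mxE; have [iC|_] := boolP (_ \in C); last by rewrite mul0rn.
  by case/eqP: neqC; rewrite (def_pblock _ PC iC) //; apply/trivIsetP.
have subM C : C \in P -> (restrict_mx M C <= M)%MS.
  by move=> PC; rewrite -DM // submxMl.
have eqM : (M :=: \sum_(C in P) restrict_mx M C)%MS.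
  apply/eqmxP/andP; split; last exact/sumsmx_subP.
  by rewrite {1}sumM summx_sub_sums.
rewrite eqM (mxdirectP _) /=.
  by apply: eq_bigr => C _; rewrite rank_induced.
(* A common vector [u] is fixed by [D B], which kills the blocks of all other components. *)
apply/mxdirect_sumsP=> B PB; apply/eqP/rowV0P=> u.
rewrite sub_capmx => /andP[/submxP[w defu] /sub_sumsmxP[z defu']].
have -> : u = u *m D B.
  by rewrite defu /restrict_mx -!mulmxA DD // eqxx.
rewrite defu' mulmx_suml big1 // => C /andP[PC neqCB].
by rewrite /restrict_mx -!mulmxA DD // (negPf neqCB) !mulmx0.
Qed.

Lemma nullity_components (R : realFieldType) (T : finType) (G : signed_graph T) :
  nullity R G = (\sum_(C in components G) nullity R (induced G C))%N.
Proof.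
apply: (@addIn (\rank (adjmx R G))); rewrite nullityE rank_components.
rewrite -big_split -cardsT (card_partition (components_partition G)) /=.
by apply: eq_bigr => C _; rewrite nullityE card_sig.
Qed.

(** * Adding and deleting a vertex *)

Lemma mask_delta (R : nzRingType) (T : finType) (A : {set T}) (v : T) :
  v \notin A -> mask R A *m (delta_mx (0 : 'I_1) (enum_rank v))^T = 0.
Proof.
move=> vA; apply/matrixP=> i j; rewrite mul_diag_mx !mxE.
have [->|] := eqVneq i (enum_rank v); last by rewrite andbF mulr0.
by rewrite enum_rankK (negPf vA) mul0r.
Qed.

(** This puts the addition of a vertex in the form treated by [rank_border]; the zero diagonal entry
    leaves no term at [(k, k)]. *)
Lemma restrict_mxU1 (R : nzRingType) (T : finType) (M : 'M[R]_#|T|)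
    (A : {set T}) (v : T) (k := enum_rank v) (b := row k M *m mask R A) :
  M^T = M -> M k k = 0 -> v \notin A ->
  restrict_mx M (v |: A)
    = restrict_mx M A + (delta_mx 0 k)^T *m b + b^T *m delta_mx 0 k.
Proof.
move=> symM Mkk vA; apply/matrixP=> i j.
have Mki l : M k l = M l k by rewrite -[in LHS]symM mxE.
have bE l : b 0 l = if enum_val l \in A then M l k else 0.
  by rewrite /b mul_mx_diag !mxE Mki; case: ifP; rewrite ?mulr1 ?mulr0.
have outerE (x y : 'rV[R]_#|T|) : (x^T *m y) i j = x 0 i * y 0 j.
  by rewrite mxE big_ord1 mxE.
rewrite restrict_mxE [RHS]mxE [(_ + _ *m b) i j]mxE restrict_mxE !outerE !bE.
rewrite ![delta_mx _ _ _ _]mxE /= !inE.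
have eqv l : (enum_val l == v) = (l == k).
  by rewrite -[v]enum_rankK (inj_eq enum_val_inj).
have kA : (enum_val k \in A) = false by rewrite enum_rankK (negPf vA).
rewrite !eqv; have [->|_] := eqVneq i k; have [->|_] := eqVneq j k.
- by rewrite kA Mkk mulr0 mul0r !addr0.
- by rewrite kA mul1r mul0r addr0 add0r Mki.
- by rewrite kA andbF andbT mul0r !add0r mulr1.
- by rewrite mul0r mulr0 !addr0.
Qed.

Theorem theorem3p1 (R : realFieldType) (T : finType) (G : signed_graph T)
    (v : T) (C1 : {set {x : T | x \in [set~ v]}}) :
  connected G ->
  cut_point G v ->
  C1 \in components (delv G v) ->
  nullity R (induced (delv G v) C1)
    = (nullity R (induced G (v |: [set val x | x in C1])) + 1)%N ->
  (nullity R G)%:Z = (nullity R (delv G v))%:Z - 1 /\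
  (nullity R (delv G v))%:Z - 1
    = (\sum_(C in components (delv G v))
         (nullity R (induced (delv G v) C))%:Z) - 1.
Proof.
move=> _ _ compC1 eta1.
split; last by rewrite nullity_components (big_morph Posz PoszD (erefl _)).
set A : {set T} := [set val x | x in C1] in eta1.
set M := adjmx R G; set k := enum_rank v.
have symM : M^T = M := tr_adjmx R G.
have Mkk : M k k = 0 by rewrite mxE edge_irr.
have vA : v \notin A.
  by apply/imsetP=> -[x _ vx]; have := valP x; rewrite -vx !inE eqxx.
have edge_A x y : x \in [set~ v] -> edge G x y -> y \in A -> x \in A.
  move=> xV xy /imsetP[y' y'C yE]; apply/imsetP; exists (Sub x xV) => //.
  have : edge (delv G v) (Sub x xV) y' by rewrite yE in xy.
  by move/(edge_components compC1) => ->.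
have sAV : A \subset [set~ v].
  by apply/subsetP=> x xA; rewrite !inE; apply: contraNneq vA => <-.
have vV : v \notin [set~ v] by rewrite !inE eqxx.
pose b B := row k M *m mask R B.
have symB B : (restrict_mx M B)^T = restrict_mx M B.
  by rewrite /restrict_mx !trmx_mul tr_diag_mx symM mulmxA.
have delta1 : delta_mx 0 k *m (delta_mx 0 k)^T = 1%:M :> 'M[R]_1.
  by rewrite trmx_delta mul_delta_mx; apply/matrixP=> i j; rewrite !ord1 !mxE.
have rank_A : \rank (adjmx R (induced (delv G v) C1)) = \rank (restrict_mx M A).
  rewrite (rank_adjmx_embed R (h := val \o val) (G := G)) //; last first.
    by apply: inj_comp; apply: val_inj.
  congr (\rank (restrict_mx _ _)); apply/setP=> x.
  apply/imsetP/imsetP => [[y _ ->]|[y yC ->]]; first by exists (val y) => //; apply: valP.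
  by exists (Sub y yC).
(* Adding [v] brings one more vertex and one less in nullity, so the rank grows by 2, against
   [rank_border_le]. *)
have notA : ~~ (b A <= restrict_mx M A)%MS.
  apply/negP=> /(rank_border_le (delta_mx 0 k)); rewrite -restrict_mxU1 //.
  have := nullityE R (induced G (v |: A)).
  have := nullityE R (induced (delv G v) C1).
  rewrite eta1 rank_A rank_induced !card_sig cardsU1 vA /= (card_imset _ val_inj).
  move=> <-; rewrite -[in RHS]addnA [in RHS]addnCA => /addnI ->.
  by rewrite !add1n addn1 ltnn.
(* Right multiplication by [mask R A] carries a membership over [G - v] to one over [A]: in the
   columns of [A], the rows of [G - v] outside [A] vanish by [edge_A]. *)
have notV : ~~ (b [set~ v] <= restrict_mx M [set~ v])%MS.
  apply: contra notA => /(submxMr (mask R A)).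
  have -> : b [set~ v] *m mask R A = b A.
    by rewrite /b -mulmxA maskM (setIidPr sAV).
  move/submx_trans; apply.
  suff -> : restrict_mx M [set~ v] *m mask R A = mask R [set~ v] *m restrict_mx M A.
    exact: submxMl.
  rewrite /restrict_mx -!mulmxA maskM (setIidPr sAV).
  apply/matrixP=> i j; rewrite !mul_diag_mx !mul_mx_diag !mxE.
  case: (boolP (enum_val i \in [set~ v])) => [iV|_]; last by rewrite !mul0r.
  case: (boolP (enum_val j \in A)) => [jA|_]; last by rewrite !mulr0.
  case: ifP => [ij|_]; last by rewrite !(mul0r, mulr0).
  by rewrite (edge_A _ _ iV ij jA) !mul1r.
have rankG : \rank M = (\rank (restrict_mx M [set~ v]) + 2)%N.
  (* [v] and its complement exhaust [T], so this restriction is [M] itself. *)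
  have {1}-> : M = restrict_mx M (v |: [set~ v]).
    by apply/matrixP=> i j; rewrite restrict_mxE setUCr !inE.
  rewrite restrict_mxU1 // rank_border // /restrict_mx -!mulmxA mask_delta //.
    by rewrite !mulmx0.
  by rewrite mulmx0.
have etaV := nullityE R (delv G v); have etaG := nullityE R G.
rewrite rank_induced card_sig cardsC1 in etaV.
(* [G - v] has [#|T|.-1] vertices; positivity of [#|T|] makes this a true subtraction in the final
   count. *)
have T0 : (0 < #|T|)%N by apply/card_gt0P; exists v.
suff -> : nullity R (delv G v) = (nullity R G + 1)%N by rewrite PoszD addrK.
apply: (@addIn (\rank (restrict_mx M [set~ v]))); rewrite etaV.
apply: succn_inj; rewrite (prednK T0) -[LHS]etaG rankG.
by rewrite addn2 !addnS addn0 addSn.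
Qed.
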